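(* Let $S\subset\mathbb{R}^D$ be a compact domain, let $k:S\times S\to\mathbb{R}$ be a continuous positive definite kernel with reproducing kernel Hilbert space $\mathcal{H}_k$ and Mercer expansion (with respect to Lebesgue measure on $S$) $k(x,x')=\sum_{j}\eta_j e_j(x)e_j(x')$, let $a>0$ and $\gamma>0$, and let $x_1,\ldots,x_N\in S$. Define the kernel $$\tilde k(x,x')=\sum_{j}\frac{\eta_j}{a\eta_j+\gamma}\,e_j(x)e_j(x'),\qquad x,x'\in S.$$ Then there exists a solution of the optimization problem $$\min_{f\in\mathcal{H}_k}\left\{-\sum_{i=1}^N\log\bigl(a f^2(x_i)\bigr)+a\int_S f^2(x)\,dx+\gamma\|f\|_{\mathcal{H}_k}^2\right\}$$ (i.e. a function in $\mathcal{H}_k$ attaining the minimum) which takes the form $$f^*(\cdot)=\sum_{i=1}^N\alpha_i\,\tilde k(x_i,\cdot)$$ for some $\alpha_1,\ldots,\alpha_N\in\mathbb{R}$.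
   Context: ''Positive definite kernel'' means a symmetric function $k:S\times S\to\mathbb{R}$ all of whose Gram matrices $[k(y_i,y_j)]_{i,j}$ are positive semidefinite. $\mathcal{H}_k$ is the unique Hilbert space of functions $f:S\to\mathbb{R}$ with $k(x,\cdot)\in\mathcal{H}_k$ and $f(x)=\langle f,k(x,\cdot)\rangle_{\mathcal{H}_k}$ for all $f\in\mathcal{H}_k$, $x\in S$. The integral operator $T_k:L_2(S)\to L_2(S)$, $T_kg=\int_S k(x,\cdot)g(x)\,dx$ (Lebesgue measure), is positive, self-adjoint and compact. $\{e_j\}$ is an $L_2(S)$-orthonormal (at most countable) set of eigenfunctions of $T_k$, taken as continuous functions on $S$, with corresponding eigenvalues $\eta_j>0$ (only positive eigenvalues are listed, with multiplicity; $\eta_j\to0$ if there are infinitely many). Standing assumption (Mercer's representation): $k(x,x')=\sum_j\eta_je_j(x)e_j(x')$ for all $x,x'\in S$, with uniform convergence on $S\times S$. Consequently the functions in $\mathcal{H}_k$ are exactly those of the form $f=\sum_jb_je_j$ with $\|f\|_{\mathcal{H}_k}^2=\sum_jb_j^2/\eta_j<\infty$. The kernel $\tilde k$ is the kernel corresponding to the integral operator $T_k(aT_k+\gamma I)^{-1}$. Convention: $-\log 0=+\infty$, so the objective takes values in $\mathbb{R}\cup\{+\infty\}$. *)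

(* Defs.v *)
From HB Require Import structures.
From mathcomp Require Import all_boot all_order all_algebra.
From mathcomp Require Import all_classical all_reals all_analysis.
Import Order.TTheory GRing.Theory Num.Theory.
Import numFieldNormedType.Exports.
Set Implicit Arguments.
Unset Strict Implicit.
Unset Printing Implicit Defensive.
Local Open Scope classical_set_scope.
Local Open Scope ring_scope.

(* Product sigma-algebra on row vectors, as the library does for tuples; over
   the reals it is the Borel sigma-algebra of 'rV[R]_n. *)
Definition measure_rV_display : measure_display -> measure_display.
Proof. exact. Qed.

Section measurable_rV.
Context {d} {T : sigmaRingType d}.
Variable n : nat.

Let coors : 'I_n -> 'rV[T]_n -> T := fun i x => x ord0 i.

Let rV_set0 : g_sigma_preimage coors set0.
Proof. exact: sigma_algebra0. Qed.

Let rV_setC A : g_sigma_preimage coors A -> g_sigma_preimage coors (~` A).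
Proof. exact: sigma_algebraC. Qed.

Let rV_bigcup (F : _^nat) : (forall i, g_sigma_preimage coors (F i)) ->
  g_sigma_preimage coors (\bigcup_i (F i)).
Proof. exact: sigma_algebra_bigcup. Qed.

HB.instance Definition _ := @isMeasurable.Build (measure_rV_display d)
  ('rV[T]_n) (g_sigma_preimage coors) rV_set0 rV_setC rV_bigcup.

End measurable_rV.

Lemma measurable_coord d (T : sigmaRingType d) n (i : 'I_n) :
  measurable_fun [set: 'rV[T]_n] (fun x => x ord0 i).
Proof.
move=> _ Y mY; rewrite setTI; apply: sub_sigma_algebra => /=.
rewrite -bigcup_seq/=; exists i => /=; first by rewrite mem_index_enum.
by exists Y => //; rewrite setTI.
Qed.

Lemma measurable_fun_rV d d1 (T : measurableType d) (T1 : measurableType d1) n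
    (f : T1 -> 'rV[T]_n) :
  (forall i, measurable_fun [set: T1] (fun x => f x ord0 i)) ->
  measurable_fun [set: T1] f.
Proof.
move=> mf.
have : g_sigma_preimage (fun i : 'I_n => (fun x : 'rV[T]_n => x ord0 i) \o f)
    `<=` measurable.
  apply: smallest_sub; first exact: sigma_algebra_measurable.
  case: n => [|n] in f mf *; first by rewrite big_ord0.
  rewrite -bigcup_mkord_ord; apply: bigcup_sub => i Ii.
  by move=> A [B mB <-]; exact: mf.
rewrite g_sigma_preimage_comp => prefS.
by move=> _ A mA; apply: prefS; exists A.
Qed.

Section lebesgue_rV.
Context {R : realType}.

Definition cons_rV n (p : R * 'rV[R]_n) : 'rV[R]_n.+1 :=
  row_mx p.1%:M p.2 : 'rV_(1 + n).

Lemma cons_rV0 n (p : R * 'rV[R]_n) : cons_rV p ord0 ord0 = p.1.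
Proof.
have -> : (ord0 : 'I_n.+1) = lshift n (ord0 : 'I_1) by exact: val_inj.
by rewrite /cons_rV (@row_mxEl _ 1 1 n) mxE eqxx mulr1n.
Qed.

Lemma cons_rVS n (p : R * 'rV[R]_n) i :
  cons_rV p ord0 (lift ord0 i) = p.2 ord0 i.
Proof. by rewrite /cons_rV -rshift1 (@row_mxEr _ 1 1 n). Qed.

Lemma measurable_cons_rV n : measurable_fun [set: R * 'rV[R]_n] (@cons_rV n).
Proof.
apply: measurable_fun_rV => i; have [j ->|->] := unliftP ord0 i.
  under eq_fun do rewrite cons_rVS.
  exact: (measurableT_comp (measurable_coord j) measurable_snd).
under eq_fun do rewrite cons_rV0.
exact: measurable_fst.
Qed.

Section lebesgue_cons.
Variables (n : nat) (m : {measure set 'rV[R]_n -> \bar R}).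

Definition lebesgue_cons : set 'rV[R]_n.+1 -> \bar R :=
  pushforward ((@lebesgue_measure R) \x^ m)%E (@cons_rV n).

Let mpre (A : set 'rV[R]_n.+1) : measurable A ->
  @measurable _ (measurableTypeR R * 'rV[R]_n)%type (@cons_rV n @^-1` A).
Proof.
move=> mA; rewrite -[X in measurable X]setTI.
exact: (measurable_cons_rV measurableT mA).
Qed.

Let lebesgue_cons0 : lebesgue_cons set0 = 0%E.
Proof. by rewrite /lebesgue_cons /pushforward preimage_set0 measure0. Qed.

Let lebesgue_cons_ge0 A : (0 <= lebesgue_cons A)%E.
Proof. by rewrite /lebesgue_cons /pushforward measure_ge0. Qed.

Let lebesgue_cons_sigma_additive : semi_sigma_additive lebesgue_cons.
Proof.
move=> F mF tF mUF; rewrite /lebesgue_cons /pushforward preimage_bigcup.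
apply: measure_semi_sigma_additive.
- by move=> i; exact: mpre.
- apply/trivIsetP => /= i j _ _ ij; rewrite -preimage_setI.
  by move/trivIsetP : tF => /(_ _ _ _ _ ij) ->//; rewrite preimage_set0.
- by rewrite -preimage_bigcup; exact: mpre.
Qed.

HB.instance Definition _ := isMeasure.Build _ _ _ lebesgue_cons
  lebesgue_cons0 lebesgue_cons_ge0 lebesgue_cons_sigma_additive.

End lebesgue_cons.

(* n-dimensional Lebesgue measure, by iterated product along
   R^n.+1 = R * R^n *)
Fixpoint lebesgue_rV n : {measure set 'rV[R]_n -> \bar R} :=
  match n with
  | 0 => dirac (0 : 'rV[R]_0)
  | n.+1 => lebesgue_cons (lebesgue_rV n)
  end.

Lemma lebesgue_rV_box n (A : 'I_n -> set R) : (forall i, measurable (A i)) ->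
  lebesgue_rV n [set x | forall i, A i (x ord0 i)] =
  (\prod_(i < n) lebesgue_measure (A i))%E.
Proof.
elim: n A => [|n IH] A mA /=.
  by rewrite big_ord0 diracE mem_set// => -[].
rewrite big_ord_recl -(IH (fun i => A (lift ord0 i)))// -product_measure2E//.
- rewrite /lebesgue_cons /pushforward; congr (_ _).
  apply/seteqP; split=> [[t v] /= Atv|[t v] [/= At Av] i].
    split=> [|i]; first by have := Atv ord0; rewrite cons_rV0.
    by have := Atv (lift ord0 i); rewrite cons_rVS.
  by have [j ->|->] := unliftP ord0 i; rewrite ?cons_rV0 ?cons_rVS.
- exact: mA.
- rewrite [X in measurable X](_ : _ = \bigcap_(i in [set: 'I_n])
      (fun x : 'rV[R]_n => x ord0 i) @^-1` A (lift ord0 i)).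
    apply: fin_bigcap_measurable => // i _.
    by rewrite -[X in measurable X]setTI; exact: measurable_coord.
  by apply/seteqP; split => [x /= H i _|x /= H i]; apply: H.
Qed.

End lebesgue_rV.

Section hilbert.
Context {R : realType} {V : lmodType R}.
Implicit Types (H : set V) (ip : V -> V -> R).

Definition ipnorm ip (u : V) : R := Num.sqrt (ip u u).

(* The values of ip outside H are irrelevant. *)
Record is_hilbert H ip : Prop := IsHilbert {
  hilbert0 : H 0;
  hilbert_lin : forall a u v, H u -> H v -> H (a *: u + v);
  ip_sym : forall u v, H u -> H v -> ip u v = ip v u;
  ip_lin : forall a u v w, H u -> H v -> H w ->
    ip (a *: u + v) w = a * ip u w + ip v w;
  ip_gt0 : forall u, H u -> u != 0 -> 0 < ip u u;
  hilbert_complete : forall u : nat -> V, (forall n, H (u n)) ->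
    (forall eps : R, 0 < eps -> exists N, forall m n, (N <= m)%N -> (N <= n)%N ->
       ipnorm ip (u m - u n) < eps) ->
    exists2 l, H l & ipnorm ip (u n - l) @[n --> \oo] --> 0
}.

End hilbert.

Section kernels.
Context {R : realType} {T : Type}.
Implicit Types k : T -> T -> R.

Definition gram_mx k n (y : 'I_n -> T) : 'M[R]_n :=
  \matrix_(i, j) k (y i) (y j).

Definition psd_mx n (G : 'M[R]_n) : Prop :=
  forall c : 'rV[R]_n, 0 <= (c *m G *m c^T) 0 0.

Definition positive_definite_kernel k : Prop :=
  (forall x y, k x y = k y x) /\
  (forall n (y : 'I_n -> T), psd_mx (gram_mx k y)).

(* H_k = (H, ip), which is determined by k (Moore-Aronszajn) up to the values
   of ip outside H *)
Record is_rkhs k (H : set (T -> R^o)) (ip : (T -> R^o) -> (T -> R^o) -> R) :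
    Prop := IsRkhs {
  rkhs_hilbert : is_hilbert H ip;
  rkhs_kernel : forall x, H (k x);
  rkhs_repr : forall f x, H f -> f x = ip f (k x)
}.

End kernels.

Section mercer.
Context {R : realType} {D : nat} (S : set 'rV[R]_D).

Local Notation mu := (@lebesgue_rV R D).

(* Functions on S are functions on the subtype S, extended by 0 when
   integrating. *)
Definition integral_operator (k : S -> S -> R) (g : S -> R) : S -> R :=
  fun y => \int[mu]_(x in S) ('valL_(0 : R) (fun x : S => k x y * g x) x).

Definition mercer_sum (J : set nat) (c : nat -> R) (e : nat -> S -> R)
    (n : nat) (x y : S) : R :=
  \sum_(0 <= j < n | j \in J) c j * e j x * e j y.

(* J is the at most countable index set of the eigensystem; eta and e are
   irrelevant outside J. Eigenfunctions are understood in L_2(S), hence the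
   almost everywhere equality. No completeness is required of e: uniform
   convergence to k forces every positive eigenvalue to be listed, with its
   multiplicity. *)
Record mercer_expansion (k : S -> S -> R) (J : set nat) (eta : nat -> R)
    (e : nat -> S -> R) : Prop := MercerExpansion {
  eigenvalue_gt0 : forall j, J j -> 0 < eta j;
  eigenfun_continuous : forall j, J j -> continuous (e j);
  eigenfun_orthonormal : forall i j, J i -> J j ->
    (\int[mu]_(x in S) ('valL_(0 : R) (fun x : S => e i x * e j x) x)%:E)%E =
    (i == j)%:R%:E;
  eigenfunP : forall j, J j ->
    ae_eq mu S ('valL_(0 : R) (integral_operator k (e j)))
               ('valL_(0 : R) (fun x : S => eta j * e j x));
  mercer_cvg :
    {uniform, (fun n (p : S * S) => mercer_sum J eta e n p.1 p.2) @ \oo -->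
              (fun p : S * S => k p.1 p.2)}
}.

(* The limit exists under mercer_expansion when 0 < a and 0 < gamma, by
   comparison with the expansion of k. *)
Definition tilde_kernel (J : set nat) (eta : nat -> R) (e : nat -> S -> R)
    (a gamma : R) (x y : S) : R :=
  limn (fun n => mercer_sum J (fun j => eta j / (a * eta j + gamma)) e n x y).

(* As lne 0 = -oo, this is +oo as soon as some f (x i) is 0. *)
Definition objective (ip : (S -> R^o) -> (S -> R^o) -> R) N (x : 'I_N -> S)
    (a gamma : R) (f : S -> R) : \bar R :=
  (- (\sum_(i < N) lne (a * f (x i) ^+ 2)%:E)
   + a%:E * \int[mu]_(y in S) ('valL_(0 : R) (fun y : S => f y ^+ 2) y)%:E
   + (gamma * ipnorm ip f ^+ 2)%:E)%E.

End mercer.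

(* Main.v *)
(* Put B f g = a * \int_S f g + gamma * <f, g>_H. Point evaluations are bounded on
   H, so B is equivalent to the inner product of H and Riesz' theorem gives rho_x
   in H with B f rho_x = f x for all f in H. Testing this with f = k y gives
   (a T_k + gamma) rho_x = k x; integrating against e_j shows that the j-th
   coefficient of rho_x is eta_j / (a eta_j + gamma) * e_j x, and then the uniform
   Mercer expansion gives rho_x = tilde_kernel x. So tilde_kernel is the
   reproducing kernel of (H, B), and B-orthogonal projection onto the span of the
   tilde_kernel (x i) keeps the values f (x i) and does not increase
   a * \int_S f^2 + gamma * |f|_H^2 = B f f. It remains to minimize over a
   finite-dimensional space, where compactness applies after rescaling. *)
Require Import Defs.
From mathcomp Require Import all_boot all_order all_algebra.
From mathcomp Require Import all_classical all_reals all_analysis.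
From mathcomp Require Import finmap ring lra.
Import Order.TTheory GRing.Theory Num.Theory.
Import numFieldNormedType.Exports.
Set Implicit Arguments.
Unset Strict Implicit.
Unset Printing Implicit Defensive.
Local Open Scope classical_set_scope.
Local Open Scope ring_scope.

(** * Lebesgue measure on compact sets *)

Lemma measurable_ball_rV {R : realType} n (c : 'rV[R]_n) (r : R) :
  measurable (ball c r).
Proof.
have [r0|r0] := leP r 0.
  rewrite (_ : ball c r = set0)//; apply/seteqP; split => // y.
  by case => /lt_le_trans /(_ r0); rewrite ltxx.
rewrite (_ : ball c r = \bigcap_(i in [set: 'I_n])
    (fun x : 'rV[R]_n => x ord0 i) @^-1` ball (c ord0 i) r).
  apply: fin_bigcap_measurable => // i _.
  rewrite -[X in measurable X]setTI; apply: measurable_coord => //.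
  by rewrite ball_itv; exact: measurable_itv.
apply/seteqP; split => [y [_ cy] i _|y cy]; first exact: cy.
by split => // i j; rewrite ord1; exact: cy.
Qed.

(** The sigma-algebra is generated by coordinates, so closed sets need an argument: [K] is the
    intersection over [m] of finite unions of balls of radius [1/(m+1)] centred in [K]. Balls for
    the max norm are boxes, hence measurable, and a point of the intersection lies in the closure of
    [K]. *)
Lemma compact_measurable_rV {R : realType} n (K : set 'rV[R]_n) :
  compact K -> measurable K.
Proof.
move=> cK.
have cov (m : nat) : exists F : {fset 'rV[R]_n}, {subset F <= K} /\
    K `<=` \bigcup_(c in [set` F]) ball c m.+1%:R^-1.
  have := cK; rewrite compact_cover => /(_ _ K (fun c => (ball c m.+1%:R^-1)°)).
  case=> [c _|c Kc|F FK KF]; first exact: open_interior.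
    by exists c => //; apply: nbhsx_ballx.
  exists F; split; first exact: FK.
  by move=> y /KF [c Fc /interior_subset cy]; exists c.
have [F FP] := choice cov.
have -> : K = \bigcap_m \bigcup_(c in [set` F m]) ball c m.+1%:R^-1.
  apply/seteqP; split => [y Ky m _|y Fy]; first by have [_] := FP m; apply.
  have /closure_id -> : closed K by apply: compact_closed => //; exact: norm_hausdorff.
  move=> B /nbhs_ballP[r /= r0 rB].
  have [m] := ltr_add_invr r0; rewrite add0r => mr.
  have [c Fc cy] := Fy m I; exists c; split.
    by apply/set_mem; have [FK _] := FP m; exact: FK.
  by apply: rB; apply: ball_sym; apply: le_ball cy; exact: ltW.
apply: bigcapT_measurable => m; apply: fin_bigcup_measurable.
  exact: finite_fset.
by move=> c _; exact: measurable_ball_rV.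
Qed.

(** Boundedness puts [K] inside a cube, whose measure is a finite product of interval lengths. The
    half-side is [M + 1] because [M] itself only yields bounds strictly above it. *)
Lemma compact_lebesgue_rV_lty {R : realType} n (K : set 'rV[R]_n) :
  compact K -> (lebesgue_rV n K < +oo)%E.
Proof.
move=> cK; have [M [_ KM]] := compact_bounded cK.
have mI (i : 'I_n) : measurable (`[- (M + 1), M + 1] : set R) by [].
set B := [set y : 'rV[R]_n | forall i, `[- (M + 1), M + 1]%classic (y ord0 i)].
have mB : measurable B.
  rewrite (_ : B = \bigcap_(i in [set: 'I_n])
      (fun y : 'rV[R]_n => y ord0 i) @^-1` `[- (M + 1), M + 1]).
    apply: fin_bigcap_measurable => // i _.
    by rewrite -[X in measurable X]setTI; exact: measurable_coord.
  by apply/seteqP; split => [y yM i _|y yM i]; exact: yM.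
have KB : K `<=` B.
  move=> y /KM => /(_ (M + 1)); rewrite ltrDl ltr01 => /(_ isT) yM i /=.
  rewrite in_itv/= -ler_norml; apply: le_trans yM.
  rewrite [leRHS]/Num.norm /= mx_normrE; apply/bigmax_geP; right => /=.
  by exists (ord0, i).
suff BLT : (lebesgue_rV n B < +oo)%E.
  apply: le_lt_trans (le_measure _ _ _ KB) BLT.
  - by apply: mem_set; have := compact_measurable_rV cK.
  - exact: mem_set.
have -> : lebesgue_rV n B =
    (\prod_(i < n) lebesgue_measure ([set` `[(- (M + 1))%R, (M + 1)%R]] : set R))%E.
  exact (lebesgue_rV_box mI).
rewrite ltey_eq; apply/orP; left.
apply: (big_ind (fun u => u \is a fin_num)) => // [u v|i _]; first exact: fin_numM.
by rewrite lebesgue_measure_itv; case: ifP.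
Qed.

(** * Continuity of finite sums and products of real-valued functions *)

Section continuous_real.
Context {R : realType} {T : topologicalType}.
Implicit Types f g : T -> R.

Lemma continuous_add f g : continuous f -> continuous g ->
  continuous (fun x => f x + g x).
Proof. by move=> cf cg x; apply: (@continuousD _ _ _ f g); [exact: cf|exact: cg]. Qed.

Lemma continuous_mul f g : continuous f -> continuous g ->
  continuous (fun x => f x * g x).
Proof. by move=> cf cg x; apply: (@continuousM _ _ f g); [exact: cf|exact: cg]. Qed.

Lemma continuous_scale c f : continuous f -> continuous (fun x => c * f x).
Proof. by move=> cf; apply: continuous_mul => //; exact: cst_continuous. Qed.

Lemma continuous_sum (I : Type) (r : seq I) (P : pred I) (F : I -> T -> R) :
  (forall i, P i -> continuous (F i)) ->
  continuous (fun x => \sum_(i <- r | P i) F i x).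
Proof.
move=> cF; elim: r => [|i r IH].
  under eq_fun do rewrite big_nil.
  exact: cst_continuous.
under eq_fun do rewrite big_cons; case: (boolP (P i)) => // Pi.
by apply: continuous_add => //; exact: cF.
Qed.

Lemma continuous_prod (I : Type) (r : seq I) (P : pred I) (F : I -> T -> R) :
  (forall i, P i -> continuous (F i)) ->
  continuous (fun x => \prod_(i <- r | P i) F i x).
Proof.
move=> cF; elim: r => [|i r IH].
  under eq_fun do rewrite big_nil.
  exact: cst_continuous.
under eq_fun do rewrite big_cons; case: (boolP (P i)) => // Pi.
by apply: continuous_mul => //; exact: cF.
Qed.

End continuous_real.

(** * Integration of continuous functions over the compact set [S] *)

Section integral_on_compact.
Context {R : realType} {D : nat} (S : set 'rV[R]_D).
Hypothesis cS : compact S.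
Implicit Types f g : S -> R.

Definition integral_on f : R := \int[lebesgue_rV D]_(x in S) 'valL_(0 : R) f x.

Lemma valL_set_val f (s : S) : 'valL_(0 : R) f (set_val s) = f s.
Proof. by rewrite -[in RHS](@valLK _ _ (0 : R) S f). Qed.

Lemma valL_in f x (Sx : S x) : 'valL_(0 : R) f x = f (SigSub (mem_set Sx)).
Proof. by rewrite -[x in LHS]/(set_val (SigSub (mem_set Sx))) valL_set_val. Qed.

(** Near-coverings transport along [set_val]: the subtype carries the initial topology, so a
    neighbourhood of one of its points contains the trace of an open set of the ambient space. *)
Lemma compact_set_typeT : compact [set: S].
Proof.
rewrite compact_near_coveringP => J F P FF PF.
have := cS; rewrite compact_near_coveringP.
move=> /(_ J F (fun i x => forall s : S, set_val s = x -> P i s) FF).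
have cov (x : 'rV[R]_D) : S x ->
    \forall x' \near x & i \near F, forall s : S, set_val s = x' -> P i s.
  move=> Sx; have [[/= U V] [Us FV] UVP] := PF (SigSub (mem_set Sx)) I.
  case: Us => _ [[W oW <-] /= Wx WU].
  exists (W, V) => /=; first by split => //; exact: open_nbhs_nbhs.
  by move=> [y i] [/= Wy Vi] s sy; apply: (UVP (s, i)); split => //; apply: WU => /=; rewrite sy.
move=> /(_ cov); apply: filterS => i Pi s _.
by apply: (Pi (set_val s)) => //; apply: set_valP.
Qed.

Lemma compact_image_set_val (A : set S) : closed A -> compact (set_val @` A).
Proof.
move=> cA; apply: continuous_compact.
  by apply: continuous_subspaceT; exact: initial_continuous.
exact: subclosed_compact cA compact_set_typeT _.
Qed.

(** It suffices to test closed half-lines. Their preimages are closed in the compact space [S], so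
    their images in the ambient space are compact, hence measurable. *)
Lemma continuous_measurable_valL f : continuous f ->
  measurable_fun S ('valL_(0 : R) f).
Proof.
move=> cf; apply: (measurability (@measurable_realfun.RGenCInfty.G R)) => [|/= _ [_] [r] -> <-].
  exact: measurable_realfun.RGenCInfty.measurableE.
rewrite (_ : _ `&` _ = set_val @` (f @^-1` [set y | r <= y])).
  apply: compact_measurable_rV; apply: compact_image_set_val.
  by apply: closed_comp => [y _|]; [exact: cf|exact: closed_ge].
apply/seteqP; split => [x [Sx]|_ [s rs <-]].
  rewrite /preimage /mkset (valL_in _ Sx) in_itv andbT => rx.
  by exists (SigSub (mem_set Sx)).
by split; [exact: set_valP|rewrite /preimage /mkset valL_set_val in_itv/= andbT].
Qed.

Lemma continuous_bounded_on f : continuous f -> exists M, forall s, `|f s| <= M.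
Proof.
move=> cf; have : bounded_set (f @` [set: S]).
  by apply/compact_bounded/continuous_compact;
    [exact: continuous_subspaceT|exact: compact_set_typeT].
case=> M [_ fM]; exists (M + 1) => s; apply: (fM (M + 1)); first by rewrite ltrDl.
by exists s.
Qed.

Lemma continuous_integrable_valL f : continuous f ->
  (lebesgue_rV D).-integrable S (EFin \o 'valL_(0 : R) f).
Proof.
move=> cf; apply: measurable_bounded_integrable.
- exact: compact_measurable_rV.
- exact: compact_lebesgue_rV_lty.
- exact: continuous_measurable_valL.
have [M fM] := continuous_bounded_on cf.
exists M; split; first exact: num_real.
by move=> r Mr x Sx; rewrite /mkset (valL_in _ Sx) (le_trans _ (ltW Mr)).
Qed.

Lemma integral_onE f : continuous f ->
  (\int[lebesgue_rV D]_(x in S) ('valL_(0 : R) f x)%:E)%E = (integral_on f)%:E.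
Proof.
move=> cf; rewrite /integral_on /Rintegral fineK//; apply: integrable_fin_num.
  exact: compact_measurable_rV.
exact: continuous_integrable_valL.
Qed.


Lemma integral_on_linear c f g : continuous f -> continuous g ->
  integral_on (fun s => c * f s + g s) = c * integral_on f + integral_on g.
Proof.
move=> cf cg; have mS : measurable S by exact: compact_measurable_rV.
rewrite /integral_on -RintegralZl//; last exact: continuous_integrable_valL.
rewrite -RintegralD//.
- by apply: eq_Rintegral => x /set_mem Sx; rewrite !(valL_in _ Sx).
- have ccf : continuous (fun s => c * f s).
    by move=> s; apply: continuousM; [exact: cst_continuous|exact: cf].
  apply: eq_integrable (continuous_integrable_valL ccf) => // x /set_mem Sx.
  by rewrite /comp !(valL_in _ Sx).
- exact: continuous_integrable_valL.
Qed.

Lemma integral_on_ge0 f : (forall s, 0 <= f s) -> 0 <= integral_on f.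
Proof. by move=> f0; apply: Rintegral_ge0 => x Sx; rewrite (valL_in _ Sx). Qed.

Lemma integral_onZ c f : continuous f ->
  integral_on (fun s => c * f s) = c * integral_on f.
Proof.
move=> cf; have c0 : continuous (fun _ : S => 0 : R) by exact: cst_continuous.
have := integral_on_linear c cf c0.
(* This instance reads [I = - I + I] for the integral [I] of the zero function, which therefore
   vanishes. *)
have := integral_on_linear (-1) c0 c0.
under eq_fun do rewrite mulr0 addr0.
under [in X in _ -> X -> _]eq_fun do rewrite addr0.
by rewrite mulN1r addNr => ->; rewrite addr0.
Qed.

Lemma integral_onD f g : continuous f -> continuous g ->
  integral_on (fun s => f s + g s) = integral_on f + integral_on g.
Proof.
move=> cf cg; have := integral_on_linear 1 cf cg.
by under eq_fun do rewrite mul1r; rewrite mul1r.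
Qed.

Lemma le_integral_on f g : continuous f -> continuous g ->
  (forall s, f s <= g s) -> integral_on f <= integral_on g.
Proof.
move=> cf cg fg; rewrite -subr_ge0 addrC -mulN1r -integral_on_linear//.
by apply: integral_on_ge0 => s; rewrite mulN1r addrC subr_ge0.
Qed.

Lemma integral_on_bound f M : continuous f -> (forall s, `|f s| <= M) ->
  `|integral_on f| <= M * integral_on (fun=> 1).
Proof.
move=> cf fM; have c1 : continuous (fun _ : S => 1 : R) by exact: cst_continuous.
have cM : continuous (fun _ : S => M * 1) by exact: cst_continuous.
have cN : continuous (fun s => -1 * f s).
  exact: continuous_scale.
rewrite -integral_onZ// ler_norml; apply/andP; split.
  rewrite lerNl -mulN1r -integral_onZ//; apply: le_integral_on => // s.
  by rewrite mulN1r mulr1 lerNl; have := fM s; rewrite ler_norml => /andP[].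
apply: le_integral_on => // s; rewrite mulr1.
exact: le_trans (ler_norm _) (fM s).
Qed.

End integral_on_compact.

(** * Hilbert spaces *)

Section hilbert_theory.
Context {R : realType} {V : lmodType R}.
Implicit Types (H : set V) (ip : V -> V -> R).

Section hilbert_basics.
Variables (H : set V) (ip : V -> V -> R).
Hypothesis hH : is_hilbert H ip.

Lemma hilbertZ c u : H u -> H (c *: u).
Proof.
by move=> Hu; have := hilbert_lin hH c Hu (hilbert0 hH); rewrite addr0.
Qed.

Lemma hilbertD u v : H u -> H v -> H (u + v).
Proof. by move=> Hu Hv; have := hilbert_lin hH 1 Hu Hv; rewrite scale1r. Qed.

Lemma hilbertB u v : H u -> H v -> H (u - v).
Proof.
by move=> Hu Hv; rewrite -scaleN1r addrC; exact: (hilbert_lin hH).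
Qed.

Lemma hilbert_sum (I : Type) (r : seq I) (P : pred I) (F : I -> V) :
  (forall i, H (F i)) -> H (\sum_(i <- r | P i) F i).
Proof.
by move=> HF; apply: big_ind => //; [exact: (hilbert0 hH)|exact: hilbertD].
Qed.

Lemma ipD u v w : H u -> H v -> H w -> ip (u + v) w = ip u w + ip v w.
Proof.
by move=> Hu Hv Hw; rewrite -[u in LHS]scale1r (ip_lin hH)// mul1r.
Qed.

Lemma ip0l w : H w -> ip 0 w = 0.
Proof.
move=> Hw; have H0 := hilbert0 hH; have := ipD H0 H0 Hw.
by rewrite addr0 -{1}[ip 0 w]addr0 => /addrI <-.
Qed.

Lemma ipZ c u w : H u -> H w -> ip (c *: u) w = c * ip u w.
Proof.
move=> Hu Hw; have := ip_lin hH c Hu (hilbert0 hH) Hw.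
by rewrite ip0l// !addr0.
Qed.

Lemma ipB u v w : H u -> H v -> H w -> ip (u - v) w = ip u w - ip v w.
Proof.
by move=> Hu Hv Hw; rewrite -scaleN1r [u + _]addrC (ip_lin hH)// mulN1r addrC.
Qed.

Lemma ip_suml (I : Type) (r : seq I) (F : I -> V) w :
  (forall i, H (F i)) -> H w ->
  ip (\sum_(i <- r) F i) w = \sum_(i <- r) ip (F i) w.
Proof.
move=> HF Hw; elim: r => [|i r IH]; first by rewrite !big_nil ip0l.
by rewrite !big_cons ipD ?IH//; exact: hilbert_sum.
Qed.

Lemma ip_ge0 u : H u -> 0 <= ip u u.
Proof.
move=> Hu; have [->|/(ip_gt0 hH Hu)/ltW//] := eqVneq u 0.
by rewrite ip0l//; exact: (hilbert0 hH).
Qed.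

Lemma ipnorm_sqr u : H u -> ipnorm ip u ^+ 2 = ip u u.
Proof. by move=> Hu; rewrite sqr_sqrtr// ip_ge0. Qed.

Lemma ip_expand t u w : H u -> H w ->
  ip (t *: w + u) (t *: w + u) = t ^+ 2 * ip w w + 2 * t * ip w u + ip u u.
Proof.
move=> Hu Hw; have Hs : H (t *: w + u) by exact: (hilbert_lin hH).
rewrite (ip_lin hH)// ![ip _ (_ + _)](ip_sym hH)// !(ip_lin hH)//.
by rewrite (ip_sym hH Hu Hw); ring.
Qed.

Lemma cauchy_schwarz u v : H u -> H v -> ip u v ^+ 2 <= ip u u * ip v v.
Proof.
move=> Hu Hv; have [->|v0] := eqVneq v 0.
  by rewrite (ip_sym hH)// ?ip0l ?mulr0 ?expr0n//; exact: (hilbert0 hH).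
have vv := ip_gt0 hH Hv v0.
(* The coefficient is the one minimizing the norm of [t *: v + u] over [t]: the vector is [u] minus
   its projection on [v]. *)
have := ip_ge0 (hilbert_lin hH (- (ip u v / ip v v)) Hv Hu).
rewrite ip_expand// (ip_sym hH Hv Hu) => q0.
suff : 0 <= (ip u u * ip v v - ip u v ^+ 2) / ip v v.
  by rewrite pmulr_lge0 ?invr_gt0// subr_ge0.
by apply: le_trans q0 _; rewrite le_eqVlt; apply/orP; left; apply/eqP; field; rewrite gt_eqF.
Qed.

Lemma normr_ip u v : H u -> H v -> `|ip u v| <= ipnorm ip u * ipnorm ip v.
Proof.
move=> Hu Hv; rewrite -ler_sqr ?nnegrE ?mulr_ge0 ?sqrtr_ge0//.
by rewrite real_normK ?num_real// exprMn !ipnorm_sqr// cauchy_schwarz.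
Qed.

(** Variational argument: a minimizing sequence of [J u = ip u u - 2 * L u] is Cauchy, and at its
    limit the first variation of [J], which is twice [ip w h - L w], must vanish. *)
Lemma riesz (L : V -> R) (C : R) :
  (forall c u v, H u -> H v -> L (c *: u + v) = c * L u + L v) ->
  (forall u, H u -> `|L u| <= C * ipnorm ip u) ->
  exists2 h, H h & forall u, H u -> ip u h = L u.
Proof.
move=> Llin Lbd; pose J u := ip u u - 2 * L u.
have Jexp t u w : H u -> H w ->
    J (t *: w + u) = t ^+ 2 * ip w w + 2 * t * (ip w u - L w) + J u.
  by move=> Hu Hw; rewrite /J ip_expand// Llin//; ring.
pose m := inf (J @` H).
have Jm u : H u -> m <= J u.
  move=> Hu; apply: ge_inf; last by exists u.
  (* With [s] the norm of [w], [J w >= s ^+ 2 - 2 * C * s = (s - C) ^+ 2 - C ^+ 2]. *)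
  exists (- C ^+ 2) => _ [w Hw <-]; rewrite /J -ipnorm_sqr//.
  have := Lbd w Hw; rewrite ler_norml => /andP[_ LC].
  by have := sqr_ge0 (ipnorm ip w - C); rewrite sqrrB; lra.
have /choice[u uP] : forall n : nat, exists u, H u /\ J u < m + n.+1%:R^-1.
  move=> n; have Jinf : has_inf (J @` H).
    split; first by exists (J 0), 0 => //; exact: (hilbert0 hH).
    by exists m => _ [w Hw <-]; exact: Jm.
  have n0 : 0 < n.+1%:R^-1 :> R by rewrite invr_gt0.
  by have [_ [u Hu <-] uJ] := inf_adherent n0 Jinf; exists u.
have Hu n : H (u n) by have [] := uP n.
have uJ n : J (u n) < m + n.+1%:R^-1 by have [] := uP n.
(* parallelogram law *)
have uB p q : ip (u p - u q) (u p - u q) <= 2 * (p.+1%:R^-1 + q.+1%:R^-1).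
  have Hd : H (u p - u q) by exact: hilbertB.
  have Em := Jexp 2^-1 _ _ (Hu q) Hd; have E1 := Jexp 1 _ _ (Hu q) Hd.
  rewrite scale1r subrK expr1n mul1r mulr1 in E1.
  have := Jm _ (hilbert_lin hH 2^-1 Hd (Hu q)).
  rewrite Em mulfV ?pnatr_eq0// mul1r.
  have -> : 2^-1 ^+ 2 = 4^-1 :> R by field.
  have := uJ p; have := uJ q; rewrite E1.
  move: (ip _ _) (_ - L _) (J _) p.+1%:R^-1 q.+1%:R^-1 => a b c d e; lra.
have ucauchy (eps : R) : 0 < eps -> exists N, forall p q, (N <= p)%N ->
    (N <= q)%N -> ipnorm ip (u p - u q) < eps.
  (* For [p, q >= N] the bound [uB] is at most [4 / (N + 1)], which this choice of [N] makes smaller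
     than [eps ^+ 2]. *)
  move=> e0; have [|N] := @ltr_add_invr R 0 (eps ^+ 2 / 4).
    by rewrite divr_gt0// exprn_gt0.
  rewrite add0r => Ne; exists N => p q Np Nq.
  rewrite -ltr_sqr ?nnegrE ?sqrtr_ge0 1?ltW// ipnorm_sqr; last exact: hilbertB.
  have invle r : (N <= r)%N -> r.+1%:R^-1 <= N.+1%:R^-1 :> R.
    by move=> Nr; rewrite lef_pV2 ?posrE ?ltr0n// ler_nat.
  have := uB p q; have := invle _ Np; have := invle _ Nq.
  move: (ip _ _) p.+1%:R^-1 q.+1%:R^-1 N.+1%:R^-1 (eps ^+ 2) Ne.
  by move=> r1 r2 r3 r4 r5; lra.
have [h Hh uh] := hilbert_complete hH Hu ucauchy.
exists h => // w Hw.
have ipu : ip w (u n) @[n --> \oo] --> ip w h.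
  apply/cvgrPdist_le => /= e e0; have w0 : 0 < ipnorm ip w + 1.
    by rewrite ltr_wpDl// sqrtr_ge0.
  have /cvgrPdist_le/(_ (e / (ipnorm ip w + 1))) := uh.
  rewrite divr_gt0// => /(_ isT); apply: filterS => n.
  rewrite sub0r normrN (ger0_norm (sqrtr_ge0 _)) => nh.
  rewrite ![ip w _](ip_sym hH)// -opprB normrN.
  rewrite -ipB//.
  apply: le_trans (normr_ip (hilbertB (Hu n) Hh) Hw) _.
  rewrite ler_pdivlMr// in nh; apply: le_trans nh.
  by rewrite ler_wpM2l ?sqrtr_ge0// lerDl.
set d := ip w h - L w.
(* Since [J (u n) - 1/(n+1) < m <= J (t *: w + u n)], expanding the right-hand side cancels
   [J (u n)]; what remains depends on [u n] only through [ip w (u n)] and passes to the limit. *)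
have var t : 0 <= t ^+ 2 * ip w w + 2 * t * d.
  have cn : t ^+ 2 * ip w w + 2 * t * (ip w (u n) - L w) + n.+1%:R^-1
      @[n --> \oo] --> t ^+ 2 * ip w w + 2 * t * d + 0.
    apply: cvgD; last exact: cvg_harmonic.
    apply: cvgD; first exact: cvg_cst.
    by apply: cvgM; [exact: cvg_cst|apply: cvgB => //; exact: cvg_cst].
  rewrite -[leRHS]addr0 -(cvg_lim _ cn)//; apply: limr_ge.
    by apply/cvg_ex; eexists; exact: cn.
  apply: nearW => n; have := Jm _ (hilbert_lin hH t Hw (Hu n)).
  rewrite Jexp//; have := uJ n.
  by move: (n.+1%:R^-1) (J _) => r1 r2; lra.
(* The summand 1 keeps the denominator positive even for [w = 0]. At this [t] the quadratic is
   [d ^+ 2] times a negative number, so [d = 0]. *)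
have q0 := ip_ge0 Hw; have := var (- d / (ip w w + 1)).
have -> : (- d / (ip w w + 1)) ^+ 2 * ip w w + 2 * (- d / (ip w w + 1)) * d =
   - (d ^+ 2 * ((ip w w + 2) / (ip w w + 1) ^+ 2)).
  by field; rewrite gt_eqF//; lra.
rewrite oppr_ge0 pmulr_lle0; last by rewrite divr_gt0 ?exprn_gt0//; lra.
move=> dle; have : d ^+ 2 == 0 by rewrite eq_le dle sqr_ge0.
by rewrite sqrf_eq0 => /eqP/subr0_eq.
Qed.

End hilbert_basics.

(** Equivalent norms have the same Cauchy sequences and the same limits, so completeness carries
    over. The sign of [C] is not given, hence its absolute value under the square root. *)
Lemma is_hilbert_equiv H ip ip' (c C : R) : is_hilbert H ip -> 0 < c ->
  (forall u v, H u -> H v -> ip' u v = ip' v u) ->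
  (forall a u v w, H u -> H v -> H w ->
    ip' (a *: u + v) w = a * ip' u w + ip' v w) ->
  (forall u, H u -> c * ip u u <= ip' u u <= C * ip u u) ->
  is_hilbert H ip'.
Proof.
move=> hH c0 sym' lin' eqv.
have nle u : H u -> ipnorm ip u <= Num.sqrt c^-1 * ipnorm ip' u.
  move=> Hu; rewrite /ipnorm -sqrtrM; last by rewrite invr_ge0 ltW.
  apply: ler_wsqrtr; rewrite ler_pdivlMl//.
  by have /andP[] := eqv u Hu.
have nge u : H u -> ipnorm ip' u <= Num.sqrt `|C| * ipnorm ip u.
  move=> Hu; rewrite /ipnorm -sqrtrM//; apply: ler_wsqrtr; have /andP[_ /le_trans] := eqv u Hu.
  by apply; rewrite ler_wpM2r ?ler_norm ?(ip_ge0 hH).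
split => //.
- exact: (hilbert0 hH).
- exact: (hilbert_lin hH).
- move=> u Hu u0; have /andP[+ _] := eqv u Hu; apply: lt_le_trans.
  by rewrite mulr_gt0// (ip_gt0 hH).
move=> u Hu uC; have sc0 : 0 < Num.sqrt c^-1 by rewrite sqrtr_gt0 invr_gt0.
have [|l Hl ul] := hilbert_complete hH Hu.
  move=> e e0; have [|N NP] := uC (e / Num.sqrt c^-1); first exact: divr_gt0.
  exists N => p q Np Nq; apply: le_lt_trans (nle _ (hilbertB hH (Hu p) (Hu q))) _.
  by rewrite mulrC -ltr_pdivlMr// NP.
exists l => //; apply: (@squeeze_cvgr _ _ _ _ (fun=> 0)
    (fun n => Num.sqrt `|C| * ipnorm ip (u n - l))).
- by apply: nearW => n; rewrite sqrtr_ge0 nge//; exact: (hilbertB hH).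
- exact: cvg_cst.
- by rewrite -(mulr0 (Num.sqrt `|C|)); apply: cvgM => //; exact: cvg_cst.
Qed.

End hilbert_theory.

(** * The regularized inner product *)

Section regularized_kernel.
Context {R : realType} {D : nat} (S : set 'rV[R]_D).
Variables (k : S -> S -> R) (H : set (S -> R^o)).
Variables (ip : (S -> R^o) -> (S -> R^o) -> R) (a gamma : R).
Hypotheses (cS : compact S) (kcont : continuous (fun p : S * S => k p.1 p.2)).
Hypotheses (kH : is_rkhs k H ip) (a0 : 0 < a) (gamma0 : 0 < gamma).

Let hH := rkhs_hilbert kH.

Lemma rkhs_sym x y : k x y = k y x.
Proof.
rewrite (rkhs_repr kH y (rkhs_kernel kH x)) (rkhs_repr kH x (rkhs_kernel kH y)).
by rewrite (ip_sym hH)//; exact: (rkhs_kernel kH).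
Qed.

Lemma rkhs_eval_le f x : H f -> `|f x| <= Num.sqrt (k x x) * ipnorm ip f.
Proof.
move=> Hf; rewrite (rkhs_repr kH x Hf) mulrC.
apply: le_trans (normr_ip hH Hf (rkhs_kernel kH x)) _.
by rewrite /ipnorm -(rkhs_repr kH x (rkhs_kernel kH x)).
Qed.

Lemma kernel_diag_continuous : continuous (fun x : S => k x x).
Proof.
by move=> x; exact: (@continuous2_cvg S S S R (nbhs x) _ id id k x x (@kcont (x, x)) cvg_id cvg_id).
Qed.

Lemma kernel_continuousr x : continuous (k x).
Proof.
by move=> y; exact: (@continuous2_cvg S S S R (nbhs y) _ (fun=> x) id k x y (@kcont (x, y)) (cvg_cst x) cvg_id).
Qed.

(** By the reproducing property and Cauchy-Schwarz, [|f x - f y|] is at most the norm of [f] times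
    that of [k x - k y]. The square of the latter is [k x x - 2 * k x y + k y y], which tends to 0
    as [y] tends to [x]. *)
Lemma rkhs_continuous f : H f -> continuous (f : S -> R).
Proof.
move=> Hf x; pose q (y : S) := k x x - 2 * k x y + k y y.
have qE y : q y = ip (k x - k y) (k x - k y).
  have [Hx Hy] := (rkhs_kernel kH x, rkhs_kernel kH y).
  have Hxy : H (k x - k y) by exact: (hilbertB hH).
  rewrite (ipB hH)// ![ip _ (_ - _)](ip_sym hH)// !(ipB hH)//.
  rewrite -!(rkhs_repr kH)// /q (rkhs_sym y x); ring.
have q0 : q x = 0 by rewrite /q; ring.
have q_cont : continuous q.
  apply: continuous_add; last exact: kernel_diag_continuous.
  apply: continuous_add; first exact: cst_continuous.
  rewrite [X in continuous X](_ : _ = fun y => (- 2) * k x y).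
    by apply: continuous_scale; exact: kernel_continuousr.
  by apply/funext => y; rewrite mulNr.
have sq_cont : continuous (fun y => Num.sqrt (q y)).
  by move=> y; apply: continuous_comp; [exact: q_cont|exact: sqrt_continuous].
have cq : ipnorm ip f * Num.sqrt (q y) @[y --> x] --> (0 : R).
  have := continuous_scale (c := ipnorm ip f) sq_cont.
  by move=> /(_ x); rewrite /continuous_at q0 sqrtr0 mulr0.
apply/(@cvgrPdist_le _ _ _ _ (nbhs_filter x)) => /= r r0.
move/cvgrPdist_le : cq => /(_ r r0).
apply: filterS => y; rewrite sub0r normrN ger0_norm ?mulr_ge0 ?sqrtr_ge0//.
apply: le_trans; rewrite !(rkhs_repr kH _ Hf).
have [Hx Hy] := (rkhs_kernel kH x, rkhs_kernel kH y).
rewrite ![ip f _](ip_sym hH)// -(ipB hH)// mulrC qE.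
by apply: (normr_ip hH) => //; exact: (hilbertB hH).
Qed.

Lemma rkhs_continuousM f g : H f -> H g -> continuous (fun y => f y * g y : R).
Proof.
by move=> Hf Hg y; apply: continuousM; [exact: (rkhs_continuous Hf)
  |exact: (rkhs_continuous Hg)].
Qed.

(** The polarization of the penalty in the objective. *)
Definition regularized_ip (f g : S -> R^o) : R :=
  a * integral_on (fun y => f y * g y) + gamma * ip f g.

(** The integral term is nonnegative, which gives the lower constant [gamma]. For the upper one,
    [(u y) ^+ 2 <= k y y * ip u u], where [k y y] is bounded by [kap], is integrated over [S]. *)
Lemma regularized_hilbert : is_hilbert H regularized_ip.
Proof.
have [kap kapP] := continuous_bounded_on cS kernel_diag_continuous.
apply: (is_hilbert_equiv (C := a * (kap * integral_on (fun=> 1)) + gamma) hH gamma0).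
- move=> u v Hu Hv; rewrite /regularized_ip (ip_sym hH)//.
  by under eq_fun do rewrite mulrC.
- move=> c u v w Hu Hv Hw; rewrite /regularized_ip (ip_lin hH)//.
  have -> : integral_on (fun y => (c *: u + v) y * w y) =
      c * integral_on (fun y => u y * w y) + integral_on (fun y => v y * w y).
    rewrite -integral_on_linear//; [|exact: rkhs_continuousM|exact: rkhs_continuousM].
    by congr integral_on; apply/funext => y /=; rewrite mulrDl mulrA.
  by ring.
move=> u Hu; have uu := ip_ge0 hH Hu; have cu := rkhs_continuousM Hu Hu.
apply/andP; split.
  rewrite lerDr mulr_ge0 ?(ltW a0)//; apply: integral_on_ge0 => y.
  by rewrite -expr2 sqr_ge0.
rewrite mulrDl lerD2r -mulrA ler_pM2l//.
have : `|integral_on (fun y => u y * u y)| <=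
    kap * ip u u * integral_on (fun _ : S => 1).
  apply: integral_on_bound => // y; rewrite -expr2 normrX.
  have kyy : 0 <= k y y.
    rewrite (rkhs_repr kH y (rkhs_kernel kH y)).
    exact: (ip_ge0 hH (rkhs_kernel kH y)).
  have : `|u y| ^+ 2 <= (Num.sqrt (k y y) * ipnorm ip u) ^+ 2.
    by rewrite ler_sqr ?nnegrE ?mulr_ge0 ?sqrtr_ge0// rkhs_eval_le.
  move/le_trans; apply; rewrite exprMn sqr_sqrtr// (ipnorm_sqr hH)//.
  by rewrite ler_wpM2r// (le_trans (ler_norm _)).
move/(le_trans (ler_norm _))/le_trans; apply.
by rewrite le_eqVlt; apply/orP; left; apply/eqP; ring.
Qed.

(** Riesz applies since point evaluation is bounded for [ip], and [gamma * ip u u] is at most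
    [regularized_ip ip a gamma u u]. *)
Lemma regularized_representer x : exists2 rho, H rho &
  forall f, H f -> regularized_ip f rho = f x.
Proof.
apply: (riesz regularized_hilbert (C := Num.sqrt (k x x) * Num.sqrt gamma^-1)).
  by [].
move=> u Hu; apply: le_trans (rkhs_eval_le x Hu) _.
rewrite -mulrA ler_wpM2l ?sqrtr_ge0// /ipnorm -sqrtrM; last first.
  by rewrite invr_ge0 ltW.
apply: ler_wsqrtr; rewrite ler_pdivlMl// lerDr mulr_ge0 ?(ltW a0)//.
by apply: integral_on_ge0 => y; rewrite -expr2 sqr_ge0.
Qed.

End regularized_kernel.

(** * Mercer expansions *)

(** Serves to choose a tolerance before multiplying by [M * v]; the summand 1 covers the case
    [M * v = 0]. *)
Lemma ler_divM_succ {R : realType} (eps M v : R) : 0 <= eps -> 0 <= M * v ->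
  eps / (M * v + 1) * M * v <= eps.
Proof.
move=> eps0 Mv0; have Mv1 : 0 < M * v + 1 by rewrite ltr_wpDl.
rewrite -[_ / _ * M * v]mulrA mulrAC ler_pdivrMr// ler_wpM2l//.
by rewrite lerDl.
Qed.

Section uniform_expansions.
Context {R : realType} {D : nat} (S : set 'rV[R]_D).
Variables (J : set nat) (e : nat -> S -> R).
Hypothesis cS : compact S.
Hypothesis econt : forall j, J j -> continuous (e j).
Hypothesis eorth : forall i j, J i -> J j ->
  integral_on (fun y => e i y * e j y) = (i == j)%:R.

Let vol := integral_on (fun _ : S => 1 : R).

Let vol_ge0 : 0 <= vol. Proof. exact: integral_on_ge0. Qed.

Definition expansion_sum (c : nat -> R) n (y : S) : R :=
  \sum_(0 <= j < n | j \in J) c j * e j y.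

Definition uniform_expansion (h : S -> R) (c : nat -> R) : Prop :=
  forall eps, 0 < eps -> exists N, forall n, (N <= n)%N ->
    forall y, `|h y - expansion_sum c n y| <= eps.

Lemma integral_on_sum (I : Type) (r : seq I) (P : pred I) (F : I -> S -> R) :
  (forall i, P i -> continuous (F i)) ->
  integral_on (fun y => \sum_(i <- r | P i) F i y) =
  \sum_(i <- r | P i) integral_on (F i).
Proof.
move=> cF; elim: r => [|i r IH].
  under eq_fun do rewrite big_nil.
  rewrite big_nil -[RHS](mul0r vol) -integral_onZ//; last exact: cst_continuous.
  by congr integral_on; apply/funext => y; rewrite mul0r.
under eq_fun do rewrite big_cons; rewrite big_cons.
case: (boolP (P i)) => // Pi; rewrite integral_onD ?IH//; first exact: cF.
exact: continuous_sum.
Qed.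

Lemma expansion_sum_continuous c n : continuous (expansion_sum c n).
Proof.
apply: continuous_sum => j /set_mem Jj.
by apply: continuous_scale; exact: econt.
Qed.

(** Termwise integration against a bounded [g], with an explicit error. It yields both the
    coefficients of a uniform expansion and the expansion of the integral operator applied to a
    function. *)
Lemma expansion_integral_err h c g n d M : continuous h -> continuous g ->
  (forall y, `|h y - expansion_sum c n y| <= d) -> (forall y, `|g y| <= M) ->
  `|integral_on (fun y => h y * g y) -
    \sum_(0 <= j < n | j \in J) c j * integral_on (fun y => e j y * g y)|
  <= d * M * vol.
Proof.
move=> ch cg hd gM.
have -> : \sum_(0 <= j < n | j \in J) c j * integral_on (fun y => e j y * g y) =
    integral_on (fun y => expansion_sum c n y * g y).
  under [in RHS]eq_fun do rewrite /expansion_sum mulr_suml.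
  rewrite integral_on_sum => [|j /set_mem Jj]; last first.
    by apply: continuous_mul => //; apply: continuous_scale; exact: econt.
  apply: eq_bigr => j /set_mem Jj; rewrite -integral_onZ//.
    by congr integral_on; apply/funext => y; rewrite mulrA.
  by apply: continuous_mul => //; exact: econt.
have cs := @expansion_sum_continuous c n.
rewrite addrC -mulN1r -integral_on_linear//; try exact: continuous_mul.
apply: integral_on_bound => // [|y].
  apply: continuous_add; last exact: continuous_mul.
  by apply: continuous_scale; exact: continuous_mul.
rewrite mulN1r addrC -mulrBl normrM; apply: ler_pM => //.
Qed.

(** Integrating a partial sum against [e j] leaves only [c j] by orthonormality, and the error is
    arbitrarily small. *)
Lemma uniform_expansion_coef h c j : continuous h -> uniform_expansion h c ->
  J j -> integral_on (fun y => h y * e j y) = c j.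
Proof.
move=> ch hc Jj; apply/eqP; rewrite -subr_eq0 -normr_le0.
have [M eM] := continuous_bounded_on cS (@econt j Jj).
apply/ler_addgt0Pr => eps eps0; rewrite add0r.
have MV : 0 < `|M| * vol + 1 by rewrite ltr_wpDl// mulr_ge0.
have [|N NP] := hc (eps / (`|M| * vol + 1)); first exact: divr_gt0.
(* Partial sums stop before [n], so [n] must exceed [j] for the [j]-th term to occur. *)
pose n := maxn N j.+1; have {}NP := NP n (leq_maxl _ _).
have eM' y : `|e j y| <= `|M| by exact: le_trans (eM y) (ler_norm _).
have := expansion_integral_err ch (@econt j Jj) NP eM'.
rewrite big_mkcond (bigD1_seq j) ?mem_index_iota ?iota_uniq//=; last first.
  by rewrite leq_max ltnSn orbT.
rewrite mem_set// eorth// eqxx mulr1 big1 ?addr0; last first.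
  move=> i ij; case: ifPn => // /set_mem Ji.
  by rewrite eorth// (negbTE ij) mulr0.
by move/le_trans; apply; rewrite ler_divM_succ ?mulr_ge0// ltW.
Qed.

End uniform_expansions.

(** * Identification of the representer with [tilde_kernel] *)

Section mercer_representer.
Context {R : realType} {D : nat} (S : set 'rV[R]_D).
Variables (k : S -> S -> R) (H : set (S -> R^o)).
Variables (ip : (S -> R^o) -> (S -> R^o) -> R) (a gamma : R).
Variables (J : set nat) (eta : nat -> R) (e : nat -> S -> R).
Hypotheses (cS : compact S) (kcont : continuous (fun p : S * S => k p.1 p.2)).
Hypotheses (kH : is_rkhs k H ip) (a0 : 0 < a) (gamma0 : 0 < gamma).
Hypothesis kJ : mercer_expansion k J eta e.

Lemma eigenfun_integral_on i j : J i -> J j ->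
  integral_on (fun y => e i y * e j y) = (i == j)%:R.
Proof.
move=> Ji Jj; have := eigenfun_orthonormal kJ Ji Jj; rewrite integral_onE//.
  by case.
by apply: continuous_mul; exact: (eigenfun_continuous kJ).
Qed.

Lemma mercer_uniform eps : 0 < eps -> exists N, forall n, (N <= n)%N ->
  forall x y,
    `|k x y - expansion_sum J e (fun j => eta j * e j x) n y| <= eps.
Proof.
move=> eps0; have := mercer_cvg kJ.
move=> /(_ [set h | forall p : S * S, `|k p.1 p.2 - h p| <= eps]) /=.
case.
  apply/uniform_nbhs.
  exists [set uv : R * R | ball uv.1 eps uv.2]; split.
    exact: (entourage_ball _ (PosNum eps0)).
  by move=> h hk p; exact/ltW/(hk p).
by move=> N _ NP; exists N => n Nn x y; exact: (NP n Nn (x, y)).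
Qed.

Lemma representer_tilde_kernel x rho : H rho ->
  (forall f, H f -> regularized_ip ip a gamma f rho = f x) ->
  rho = tilde_kernel J eta e a gamma x.
Proof.
move=> Hrho repr.
have crho : continuous (rho : S -> R) := rkhs_continuous kcont kH Hrho.
have econt := eigenfun_continuous kJ.
have eorth := eigenfun_integral_on.
pose T (y : S) := integral_on (fun z => k y z * rho z).
pose c j := integral_on (fun y => e j y * rho y).
(* The representer property tested with [f = k y]; [T] is the integral operator applied to [rho]. *)
have eqn y : a * T y + gamma * rho y = k x y.
  have [Hy Hx] := (rkhs_kernel kH y, rkhs_kernel kH x).
  have := repr _ Hy; rewrite /regularized_ip (ip_sym (rkhs_hilbert kH))//.
  by rewrite -(rkhs_repr kH)// => ->; exact: (rkhs_sym kH).
have kx : uniform_expansion J e (k x) (fun j => eta j * e j x).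
  by move=> eps /mercer_uniform[N NP]; exists N => n Nn y; exact: NP.
have [M rhoM] := continuous_bounded_on cS crho.
(* The Mercer expansion of [k y], uniform in [y], is integrated term by term against [rho]. *)
have TE : uniform_expansion J e T (fun j => eta j * c j).
  move=> eps eps0; pose v := integral_on (fun _ : S => 1 : R).
  have v0 : 0 <= v by exact: integral_on_ge0.
  have MV : 0 < `|M| * v + 1 by rewrite ltr_wpDl// mulr_ge0.
  have [|N NP] := @mercer_uniform (eps / (`|M| * v + 1)); first exact: divr_gt0.
  exists N => n Nn y; have rhoM' z : `|rho z| <= `|M|.
    exact: le_trans (rhoM z) (ler_norm _).
  have := expansion_integral_err cS econt (kernel_continuousr kcont (x:=y)) crho
    (NP n Nn y) rhoM'.
  rewrite /expansion_sum; under eq_bigr do rewrite mulrAC.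
  by move/le_trans; apply; rewrite ler_divM_succ ?mulr_ge0// ltW.
have cT : continuous T.
  rewrite (_ : T = fun y => a^-1 * k x y + (- (gamma / a)) * rho y).
    apply: continuous_add; apply: continuous_scale => //.
    exact: (kernel_continuousr kcont).
  by apply/funext => y; rewrite -eqn; field; rewrite gt_eqF.
(* Comparison of the [j]-th coefficients on both sides of [eqn], then division by
   [a * eta j + gamma]. *)
have cE j : J j -> c j = eta j / (a * eta j + gamma) * e j x.
  move=> Jj; have eta0 := eigenvalue_gt0 kJ Jj.
  have E1 := uniform_expansion_coef cS econt eorth
    (kernel_continuousr kcont (x:=x)) kx Jj.
  have E2 := uniform_expansion_coef cS econt eorth cT TE Jj.
  have E3 : a * (eta j * c j) + gamma * c j = eta j * e j x.
    rewrite -E1 -E2 -(integral_onZ cS gamma); last exact: continuous_mul (econt j Jj) crho.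
    rewrite -integral_on_linear//.
    - by congr integral_on; apply/funext => y; rewrite -eqn; ring.
    - exact: continuous_mul cT (econt j Jj).
    - apply: continuous_scale; exact: continuous_mul (econt j Jj) crho.
  have den : a * eta j + gamma != 0.
    by rewrite gt_eqF// addr_gt0// mulr_gt0.
  by rewrite mulrAC -E3; field.
apply/funext => y; apply/esym/cvg_lim => //.
apply/cvgrPdist_le => /= eps eps0.
(* Convergence of the expansion of [rho] is deduced from those of [k x] and [T]: by [eqn] and [cE],
   [gamma] times its error is the error for [k x] minus [a] times the error for [T]. The two
   tolerances are chosen so that these parts add up to [gamma * eps]. *)
have [N1 N1P] := kx (gamma * eps / 2) ltac:(by rewrite divr_gt0// mulr_gt0).
have [N2 N2P] := TE (gamma * eps / (2 * a))
  ltac:(by rewrite divr_gt0// mulr_gt0).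
exists (maxn N1 N2) => // n /=; rewrite geq_max => /andP[n1 n2].
rewrite -(ler_pM2l gamma0) -[X in X * `|_|](gtr0_norm gamma0) -normrM.
have -> : gamma * (rho y - mercer_sum J (fun j => eta j / (a * eta j + gamma)) e n x y) =
   (k x y - expansion_sum J e (fun j => eta j * e j x) n y)
   - a * (T y - expansion_sum J e (fun j => eta j * c j) n y).
  rewrite -eqn.
  suff : gamma * mercer_sum J (fun j => eta j / (a * eta j + gamma)) e n x y =
    expansion_sum J e (fun j => eta j * e j x) n y -
    a * expansion_sum J e (fun j => eta j * c j) n y.
    by move=> E; rewrite mulrBr E; ring.
  rewrite /mercer_sum /expansion_sum !mulr_sumr -sumrB.
  apply: eq_bigr => j /set_mem Jj; rewrite cE//.
  have den : a * eta j + gamma != 0.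
    by rewrite gt_eqF// addr_gt0// mulr_gt0// (eigenvalue_gt0 kJ).
  by field.
apply: le_trans (ler_normB _ _) _; rewrite normrM (gtr0_norm a0).
have := N1P n n1 y; have := N2P n n2 y.
rewrite ler_pdivlMr ?mulr_gt0//.
move: `|k x y - _| `|T y - _| => r1 r2; lra.
Qed.

End mercer_representer.

(** * The finite-dimensional problem *)

Section gram_optimization.
Context {R : realType} (N : nat).
Implicit Types (K M : 'M[R]_N) (u v w : 'rV[R]_N).

Definition quad_form K v : R := (v *m K *m v^T) 0 0.

(** When [K] is the Gram matrix of the functions [tilde_kernel (x i)], [v *m K] lists the values at
    the points [x i] of the combination with coefficients [v], and [quad_form K v] is its
    penalty. *)
Definition log_objective (a : R) K v : \bar R :=
  (- (\sum_(i < N) lne (a * (v *m K) 0 i ^+ 2)%:E) + (quad_form K v)%:E)%E.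

Lemma quad_formE K v :
  quad_form K v = \sum_i \sum_j v 0 i * v 0 j * K i j.
Proof.
rewrite /quad_form mxE exchange_big /=; apply: eq_bigr => j _.
by rewrite !mxE mulr_suml; apply: eq_bigr => i _; ring.
Qed.

Lemma quad_formZ K t v : quad_form K (t *: v) = t ^+ 2 * quad_form K v.
Proof.
rewrite !quad_formE mulr_sumr; apply: eq_bigr => i _.
by rewrite mulr_sumr; apply: eq_bigr => j _; rewrite !mxE; ring.
Qed.

Lemma quad_form_continuous K : continuous (quad_form K).
Proof.
rewrite (_ : quad_form K = fun v => \sum_i \sum_j v 0 i * v 0 j * K i j).
  apply: continuous_sum => i _; apply: continuous_sum => j _.
  apply: continuous_mul; last exact: cst_continuous.
  by apply: continuous_mul; exact: coord_continuous.
by apply/funext => v; exact: quad_formE.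
Qed.

Lemma mulmx_coord_continuous M j : continuous (fun v => (v *m M) 0 j).
Proof.
rewrite (_ : (fun v => (v *m M) 0 j) = fun v => \sum_i v 0 i * M i j).
  apply: continuous_sum => i _; apply: continuous_mul.
    exact: coord_continuous.
  exact: cst_continuous.
by apply/funext => v; rewrite mxE.
Qed.

Lemma log_objective_eqy a K v i : (v *m K) 0 i = 0 ->
  log_objective a K v = +oo%E.
Proof.
move=> vi; rewrite /log_objective.
suff -> : (\sum_(i < N) lne (a * (v *m K) 0 i ^+ 2)%:E)%E = -oo%E by [].
apply/eqP; rewrite esum_eqNy; apply/existsP; exists i.
by rewrite vi expr2 !mulr0 le0_lneNy//= eqxx.
Qed.

Lemma log_objective_fin a K v : 0 < a -> (forall i, (v *m K) 0 i != 0) ->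
  log_objective a K v =
  (- ln (a ^+ N * \prod_(i < N) (v *m K) 0 i ^+ 2) + quad_form K v)%:E.
Proof.
move=> a0 vK; rewrite /log_objective EFinD EFinN; congr (- _ + _)%E.
have vi i : 0 < a * (v *m K) 0 i ^+ 2 by rewrite mulr_gt0// exprn_even_gt0//= vK.
under eq_bigr => i _ do rewrite lne_EFin//.
rewrite sumEFin; congr (_%:E).
rewrite -[X in a ^+ X](card_ord N) -prodr_const.
rewrite -big_split/=; symmetry.
have lnprod : (0 < \prod_(i < N) (a * (v *m K) 0 i ^+ 2)) /\
    ln (\prod_(i < N) (a * (v *m K) 0 i ^+ 2)) =
    \sum_(i < N) ln (a * (v *m K) 0 i ^+ 2).
  elim/big_ind2 : _ => [|x1 x2 y1 y2 [x0 <-] [y0 <-]|i _].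
  - by rewrite ln1.
  - by rewrite mulr_gt0// lnM.
  - by rewrite vi.
by case: lnprod.
Qed.

(* The minimum is sought on [Q <= N]: along a ray, [t ^+ N.*2 * expR (- t ^+ 2 * Q)]
   is largest where [t ^+ 2 * Q = N]. *)
Lemma log_objective_min a K (C : R) : 0 < a -> K^T = K ->
  (forall v, 0 <= quad_form K v) ->
  (forall v i, (v *m K) 0 i ^+ 2 <= C * quad_form K v) ->
  exists v0, forall v, (log_objective a K v0 <= log_objective a K v)%E.
Proof.
move=> a0 Ksym Kpsd KC.
(* [K] may be singular, so a generalized inverse recovers coefficients from values. It need not be
   symmetric, hence the companion identity for [P^T]. *)
have [P KPK] : exists P, K *m P *m K = K.
  by exists (pinvmx K); rewrite mulmxKpV.
have KPTK : K *m P^T *m K = K 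
  by have := congr1 trmx KPK; rewrite !trmx_mul Ksym mulmxA.
have vKPK v : v *m K *m P *m K = v *m K.
  by rewrite -[v *m K *m P]mulmxA -mulmxA KPK.
have vKPTK v : v *m K *m P^T *m K = v *m K.
  by rewrite -[v *m K *m P^T]mulmxA -mulmxA KPTK.
have QP v : quad_form K (v *m K *m P) = quad_form K v.
  by rewrite /quad_form vKPK !trmx_mul Ksym !mulmxA vKPTK.
(* The search runs over value vectors [v *m K] instead of coefficient vectors, since [KC] bounds
   only the former. The row space of [K] is the fixed space of [P *m K], and on it [q] is the
   quadratic form in terms of values. *)
pose q v := quad_form K (v *m P).
pose A := [set v : 'rV[R]_N | (forall j, (v *m (P *m K - 1%:M)) 0 j = 0) /\
  q v <= N%:R].
have AE v : A v -> v *m P *m K = v.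
  case=> + _ => vj; apply/eqP; rewrite -subr_eq0 -[X in _ - X]mulmx1 -mulmxA -mulmxBr.
  by apply/eqP/rowP => j; rewrite vj mxE.
have AP v : quad_form K v <= N%:R -> A (v *m K).
  move=> vN; split; last by rewrite /q QP.
  by move=> j; rewrite mulmxBr mulmx1 mulmxA vKPK subrr mxE.
have cA : compact A.
  apply: bounded_closed_compact.
    (* Squared entries are at most [|C| * N], and [|C| * N <= r <= r ^+ 2] for [r] beyond this
       constant, so entries are bounded by [r]. *)
    exists (`|C| * N%:R + 1); split; first exact: num_real.
    move=> r rC v Av; have r1 : 1 <= r.
      by apply: ltW; apply: le_lt_trans rC; rewrite lerDr mulr_ge0.
    rewrite /Num.norm/= mx_normrE; apply: bigmax_le => [|[i j] _ /=].
      exact: le_trans r1.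
    rewrite -ler_sqr ?nnegrE// ?(le_trans ler01)// real_normK ?num_real// ord1.
    apply: (@le_trans _ _ (`|C| * N%:R)).
      rewrite -{1}(AE _ Av); apply: le_trans (KC _ _) _.
      have [_ qN] := Av; rewrite (le_trans (ler_wpM2r (Kpsd _) (ler_norm C)))//.
      by rewrite ler_wpM2l.
    apply: (@le_trans _ _ r); last by rewrite expr2 ler_peMl// (le_trans ler01).
    by apply: ltW; apply: le_lt_trans rC; rewrite lerDl.
  have qc : continuous q.
    rewrite (_ : q = quad_form (P *m K *m P^T)).
      exact: quad_form_continuous.
    by apply/funext => v; rewrite /q /quad_form trmx_mul !mulmxA.
  rewrite (_ : A = (\bigcap_(j in [set: 'I_N])
    [set v | (v *m (P *m K - 1%:M)) 0 j = 0]) `&` [set v | q v <= N%:R]).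
    apply: closedI.
      apply: closed_bigI => j _.
      apply: (@closed_comp _ _ (fun v : 'rV[R]_N => (v *m (P *m K - 1%:M)) 0 j)
        [set y : R | y = 0]) => [v _|]; last exact: closed_eq.
      exact: mulmx_coord_continuous.
    apply: (@closed_comp _ _ q [set y : R | y <= N%:R]) => [v _|].
      exact: qc.
    exact: closed_le.
  by apply/seteqP; split => [v [vj vq]|v [vj vq]]; split => // j *; exact: vj.
have cprod : continuous (fun v : 'rV[R]_N => \prod_(i < N) v 0 i ^+ 2).
  apply: continuous_prod => i _.
  by apply: continuous_mul; exact: coord_continuous.
have [|v1 /set_mem Av1 v1max] := compact_EVT_max _ cA (continuous_subspaceT cprod).
  exists (0 *m K); apply: AP.
  by rewrite /quad_form !mul0mx mxE.
exists (v1 *m P) => v.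
have [i /eqP vi0|vi0] := pickP (fun i => (v *m K) 0 i == 0).
  by rewrite (log_objective_eqy _ vi0) leey.
have {}vi0 i : (v *m K) 0 i != 0 by rewrite vi0.
have Q1 : quad_form K (v1 *m P) <= N%:R by case: Av1.
have [N0|N0] := posnP N.
  rewrite (_ : v1 *m P = v)//.
  by apply/rowP => i; have := ltn_ord i; rewrite {2}N0.
(* Were the form zero, [KC] would make every value zero, against [vi0]; an index exists because [N]
   is positive. *)
have Q0 : 0 < quad_form K v.
  rewrite lt_def Kpsd andbT; apply/eqP => Q0.
  have := KC v (Ordinal N0); rewrite Q0 mulr0.
  by rewrite leNgt exprn_even_gt0//= vi0.
pose t := Num.sqrt (N%:R / quad_form K v).
have tt : t ^+ 2 = N%:R / quad_form K v by rewrite sqr_sqrtr// divr_ge0.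
have Qt : quad_form K (t *: v) = N%:R.
  by rewrite quad_formZ tt mulfVK// gt_eqF.
have NQ : 0 < N%:R / quad_form K v by rewrite divr_gt0// ltr0n.
set p := \prod_(i < N) (v *m K) 0 i ^+ 2.
have p0 : 0 < p.
  by apply: prodr_gt0 => i _; rewrite exprn_even_gt0//= vi0.
have {v1max} pp1 : (N%:R / quad_form K v) ^+ N * p <= \prod_(i < N) v1 0 i ^+ 2.
  have /v1max : t *: v *m K \in A by apply/mem_set/AP; rewrite Qt.
  apply: le_trans; rewrite -tt -[X in _ ^+ X](card_ord N) -prodr_const.
  rewrite -big_split/= le_eqVlt; apply/orP; left; apply/eqP.
  by apply: eq_bigr => i _; rewrite -scalemxAl [in RHS]mxE exprMn.
have p10 : 0 < \prod_(i < N) v1 0 i ^+ 2.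
  by apply: lt_le_trans pp1; rewrite mulr_gt0// exprn_gt0.
have v10 i : (v1 *m P *m K) 0 i != 0.
  rewrite AE//; apply: contraTneq p10 => v1i.
  by rewrite (bigD1 i)//= v1i expr2 !mul0r ltxx.
rewrite !log_objective_fin// lee_fin AE// -/p.
have aN : 0 < a ^+ N by rewrite exprn_gt0.
have : ln (N%:R / quad_form K v) *+ N + ln (a ^+ N * p) <=
    ln (a ^+ N * \prod_(i < N) v1 0 i ^+ 2).
  rewrite -lnXn// -lnM ?posrE ?mulr_gt0 ?exprn_gt0//.
  rewrite ler_ln ?posrE ?mulr_gt0 ?exprn_gt0//.
  by rewrite mulrCA ler_pM2l.
have nN : 0 < N%:R :> R by rewrite ltr0n.
(* This is [ln s <= s - 1] at [s = quad_form K v / N]. It bounds the gain from rescaling by the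
   change in the quadratic term, so with [Q1] the two inequalities on logarithms add up to the
   claim. *)
have : N%:R * - ln (N%:R / quad_form K v) <= quad_form K v - N%:R.
  have -> : quad_form K v - N%:R = N%:R * (quad_form K v / N%:R - 1).
    by field; rewrite gt_eqF.
  rewrite ler_pM2l// -lnV ?posrE// invf_div.
  have := @le_ln1Dx R (quad_form K v / N%:R - 1); rewrite [1 + _]addrC subrK.
  by apply; rewrite ltrBrDl subrr divr_gt0.
rewrite mulrN -[ln _ *+ N]mulr_natl.
move: Q1; set r1 := ln (N%:R / _); set r2 := ln (_ * p); set r3 := ln (a ^+ N * _); lra.
Qed.

End gram_optimization.

(** * Gram matrices and orthogonal projection onto a finite span *)

Section gram_projection.
Context {R : realType} {V : lmodType R}.
Variables (H : set V) (ip : V -> V -> R) (N : nat) (tau : 'I_N -> V).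
Hypotheses (hH : is_hilbert H ip) (Htau : forall i, H (tau i)).
Implicit Types u v : 'rV[R]_N.

Let K : 'M[R]_N := \matrix_(i, j) ip (tau i) (tau j).

Definition combination v : V := \sum_i v 0 i *: tau i.

Lemma hilbert_combination v : H (combination v).
Proof. by apply: (hilbert_sum hH) => i; exact: (hilbertZ hH). Qed.

Lemma ip_combinationl v f : H f ->
  ip (combination v) f = \sum_i v 0 i * ip (tau i) f.
Proof.
move=> Hf; rewrite /combination (ip_suml hH)//.
  by apply: eq_bigr => i _; rewrite (ipZ hH).
by move=> i; exact: (hilbertZ hH).
Qed.

Lemma ip_combination_tau v j : ip (combination v) (tau j) = (v *m K) 0 j.
Proof. by rewrite ip_combinationl// mxE; apply: eq_bigr => i _; rewrite mxE. Qed.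

Lemma ip_combination v : ip (combination v) (combination v) = quad_form K v.
Proof.
rewrite ip_combinationl; last exact: hilbert_combination.
rewrite /quad_form mxE.
apply: eq_bigr => i _; rewrite (ip_sym hH)//; last exact: hilbert_combination.
by rewrite ip_combination_tau mulrC [v^T _ _]mxE.
Qed.

Lemma gram_tr : K^T = K.
Proof. by apply/matrixP => i j; rewrite !mxE (ip_sym hH). Qed.

Lemma gram_quad_form_ge0 v : 0 <= quad_form K v.
Proof.
by rewrite -ip_combination; apply: (ip_ge0 hH); exact: hilbert_combination.
Qed.

(** Cauchy-Schwarz against [tau i]; the trace replaces [K i i] to give a constant that does not
    depend on [i]. *)
Lemma gram_row_bound v i :
  (v *m K) 0 i ^+ 2 <= (\sum_j K j j) * quad_form K v.
Proof.
rewrite -ip_combination_tau -ip_combination mulrC.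
apply: le_trans (cauchy_schwarz hH (hilbert_combination v) (Htau i)) _.
apply: ler_wpM2l; first exact: (ip_ge0 hH (hilbert_combination v)).
rewrite (bigD1 i)//= {1}/K mxE lerDl.
by apply: sumr_ge0 => j _; rewrite mxE (ip_ge0 hH).
Qed.

(** The combination is the orthogonal projection of [f] on the span of the [tau i]. Its coefficients
    solve a linear system in [K], consistent even for singular [K], and the squared norm of the
    difference from [f] is [ip f f - quad_form K v]. *)
Lemma combination_projection f : H f -> exists2 v : 'rV[R]_N,
  (forall i, (v *m K) 0 i = ip f (tau i)) & quad_form K v <= ip f f.
Proof.
move=> Hf; pose w : 'rV[R]_N := \row_i ip f (tau i).
have ip_w v : ip (combination v) f = (v *m w^T) 0 0.
  rewrite ip_combinationl// mxE; apply: eq_bigr => i _.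
  by rewrite !mxE (ip_sym hH).
have /submxP[v vE] : (w <= K)%MS.
  rewrite submxE; apply/eqP/rowP => j; rewrite [RHS]mxE.
  (* A vector killed by [K] gives a combination of norm zero, hence zero. Its inner product with [f]
     then vanishes, which is orthogonality of [w] to the cokernel. *)
  pose c := (col j (cokermx K))^T.
  have cK : c *m K = 0.
    by rewrite -gram_tr -trmx_mul colE mulmxA mulmx_coker mul0mx trmx0.
  have c0 : combination c = 0.
    apply/eqP; apply: contraT => /(ip_gt0 hH (hilbert_combination c)).
    by rewrite ip_combination /quad_form cK mul0mx mxE ltxx.
  have := ip_w c; rewrite c0 (ip0l hH)// => /esym.
  rewrite -[c in c *m _]trmxK -trmx_mul mxE /c trmxK => <-.
  by rewrite !mxE; apply: eq_bigr => i _; rewrite !mxE.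
exists v => [i|]; first by rewrite -vE mxE.
have := ip_ge0 hH (hilbert_lin hH (-1) (hilbert_combination v) Hf).
rewrite (ip_expand hH)//; last exact: hilbert_combination.
rewrite ip_combination ip_w vE trmx_mul gram_tr mulmxA -/(quad_form K v).
by rewrite sqrrN expr1n mul1r mulrN1; lra.
Qed.

End gram_projection.

(** * Reduction of the objective to the finite-dimensional problem *)

Lemma objectiveE {R : realType} {D : nat} (S : set 'rV[R]_D)
    (k : S -> S -> R) (H : set (S -> R^o))
    (ip : (S -> R^o) -> (S -> R^o) -> R) (a gamma : R) (N : nat)
    (x : 'I_N -> S) (f : S -> R^o) :
  compact S -> continuous (fun p : S * S => k p.1 p.2) -> is_rkhs k H ip ->
  H f ->
  objective ip x a gamma f =
  (- (\sum_(i < N) lne (a * f (x i) ^+ 2)%:E) +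
   (regularized_ip ip a gamma f f)%:E)%E.
Proof.
move=> cS kcont kH Hf; rewrite /objective integral_onE//; last first.
  by apply: continuous_mul; exact: (rkhs_continuous kcont kH Hf).
by rewrite (ipnorm_sqr (rkhs_hilbert kH))// -EFinM -addeA -EFinD.
Qed.

Theorem theorem1 (R : realType) (D : nat) (S : set 'rV[R]_D)
  (k : S -> S -> R) (H : set (S -> R^o))
  (ip : (S -> R^o) -> (S -> R^o) -> R)
  (J : set nat) (eta : nat -> R) (e : nat -> S -> R)
  (a gamma : R) (N : nat) (x : 'I_N -> S) :
  compact S ->
  continuous (fun p : S * S => k p.1 p.2) ->
  positive_definite_kernel k ->
  is_rkhs k H ip ->
  mercer_expansion k J eta e ->
  0 < a -> 0 < gamma ->
  exists alpha : 'I_N -> R,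
    let fstar : S -> R^o := fun y =>
      \sum_(i < N) alpha i * tilde_kernel J eta e a gamma (x i) y in
    H fstar /\
    forall f, H f ->
      (objective ip x a gamma fstar <= objective ip x a gamma f)%E.
Proof.
move=> cS kcont _ kH kJ a0 gamma0.
pose B := regularized_ip ip a gamma.
have hB : is_hilbert H B by exact: regularized_hilbert.
pose tau i : S -> R^o := tilde_kernel J eta e a gamma (x i).
have tauP i : H (tau i) /\ forall f, H f -> B f (tau i) = f (x i).
  have [rho Hrho rhoP] := regularized_representer cS kcont kH a0 gamma0 (x i).
  by rewrite /tau -(representer_tilde_kernel cS kcont kH a0 gamma0 kJ Hrho rhoP).
have Htau i : H (tau i) by have [] := tauP i.
have Btau i f : H f -> B f (tau i) = f (x i) by have [_] := tauP i; apply.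
pose K : 'M[R]_N := \matrix_(i, j) B (tau i) (tau j).
have obj_comb v : objective ip x a gamma (combination tau v) = log_objective a K v.
  have Hv : H (combination tau v) by exact: hilbert_combination hB Htau v.
  rewrite (objectiveE a gamma x cS kcont kH Hv) -/(B _ _).
  rewrite (ip_combination hB Htau) /log_objective; congr (- _ + _)%E.
  by apply: eq_bigr => i _; rewrite -Btau// (ip_combination_tau hB Htau).
have [v0 v0P] := log_objective_min a0 (gram_tr hB Htau)
  (gram_quad_form_ge0 hB Htau) (gram_row_bound hB Htau).
exists (fun i => v0 0 i) => fstar.
have -> : fstar = combination tau v0.
  by apply/funext => y; rewrite /combination fct_sumE.
split; first exact: hilbert_combination hB Htau v0.
(* The projection of [f] has the same values at the points [x i] and no larger penalty, so its
   objective is at most that of [f] and at least that of the minimizer [v0]. *)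
move=> f Hf; have [v vf vQ] := combination_projection hB Htau Hf.
rewrite obj_comb; apply: le_trans (v0P v) _.
rewrite (objectiveE a gamma x cS kcont kH Hf) /log_objective.
under eq_bigr do rewrite vf Btau//.
by apply: leeD2l; rewrite lee_fin.
Qed.
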